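(* For any odd integer $k=2m-1\ge1$, the space $\mathcal{N}^k_n=\mathcal{DNS}^k_n(x_{(k+1):(n-1)},[a,b])$ of $k$th degree discrete natural splines on $[a,b]$ with knots $x_{(k+1):(n-1)}=\{x_{k+1},\ldots,x_{n-1}\}$ is spanned by the following $n-k-1$ functions: $$L^k_j=\sum_{i=1}^{k+1}x_i^{j-1}\cdot N^k_i,\quad j=1,\ldots,m,$$ $$N^k_j,\quad j=k+2,\ldots,n-k-1,$$ $$R^k_j=\sum_{i=n-k}^n(x_i-x_{n-k-1})^{j-1}\cdot N^k_i,\quad j=1,\ldots,m,$$ where $N^k_1,\ldots,N^k_n$ are the normalized discrete B-spline basis functions.
   Context: Design points: $a\le x_1<\cdots<x_n\le b$, with $n\ge2k+2$, and $x_{n+1}=b$. ''Degree $d$ polynomial'' means degree at most $d$; $0^0=1$; empty products equal 1. Divided differences: $f[z]=f(z)$ and $f[z_1,\ldots,z_{r+1}]=(f[z_2,\ldots,z_{r+1}]-f[z_1,\ldots,z_r])/(z_{r+1}-z_1)$ for distinct points. Discrete derivatives: $\Delta^0_n=\mathrm{Id}$ and, for $\ell\ge1$, $(\Delta^\ell_nf)(x)=\ell!\,f[x_{i-\ell+1},\ldots,x_i,x]$ if $x\in(x_i,x_{i+1}]$, $i\ge\ell$; $(\Delta^\ell_nf)(x)=i!\,f[x_1,\ldots,x_i,x]$ if $x\in(x_i,x_{i+1}]$, $1\le i<\ell$; $(\Delta^\ell_nf)(x)=f(x)$ if $x\le x_1$. Discrete (natural) splines: write the knots as $t_1<\cdots<t_r$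 (here $t_i=x_{k+i}$, $r=n-k-1$), $t_0=a$, $t_{r+1}=b$, $I_0=[t_0,t_1]$, $I_i=(t_i,t_{i+1}]$ for $i=1,\ldots,r$. $\mathcal{DNS}^k_n(t_{1:r},[a,b])$ is the set of functions $f$ on $[a,b]$ such that: for each $i=0,\ldots,r$ there is a $k$th degree polynomial $p_i$ with $f|_{I_i}=p_i|_{I_i}$; for each $i=1,\ldots,r$, $(\Delta^\ell_np_{i-1})(t_i)=(\Delta^\ell_np_i)(t_i)$ for $\ell=0,\ldots,k-1$; and $(\Delta^\ell_np_0)(t_1)=0$ and $(\Delta^\ell_np_r)(t_r)=0$ for $\ell=m,\ldots,k$ (equivalently, $p_0$ and $p_r$ are polynomials of degree $m-1$). DB-splines: let $h^k_j(x)=\frac1{(j-1)!}\prod_{\ell=1}^{j-1}(x-x_\ell)$ for $j=1,\ldots,k+1$, $h^k_j(x)=\frac1{k!}\prod_{\ell=j-k}^{j-1}(x-x_\ell)\cdot1\{x>x_{j-1}\}$ for $j=k+2,\ldots,n$, and $\mathcal{H}^k_n=\mathrm{span}\{h^k_1,\ldots,h^k_n\}$ (the space of $k$th degree discrete splines with knots $x_{(k+1):(n-1)}$, of dimension $n$). $N^k_j$ is the unique function in $\mathcal{H}^k_n$ with $N^k_j(x_i)=\delta_{ij}$, $i=1,\ldots,n$. *)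

(* Defs.v *)
From mathcomp Require Import all_boot all_order all_algebra.
From mathcomp Require Import boolp classical_sets reals.

Set Implicit Arguments.
Unset Strict Implicit.
Unset Printing Implicit Defensive.

Import Order.TTheory GRing.Theory Num.Theory.
Local Open Scope ring_scope.

(* Conventions.
   - The points x_1, ..., x_n, x_{n+1} are given by x : nat -> R with the same
     1-based indices; x 0 and x i for i > n + 1 are never used.
   - A function on [a, b] is a total function R -> R considered up to equality
     on `[a, b]: membership in span_on, dspline and dns only depends on the
     restriction to `[a, b]. *)

Section Defs.
Variable R : realType.
Implicit Types (x t z : nat -> R) (f : R -> R) (a b u : R).

Definition span_on a b (s : seq (R -> R)) : set (R -> R) :=
  [set f | exists c : nat -> R, {in `[a, b],
     forall u, f u = \sum_(i < size s) c i * nth (fun=> 0) s i u}].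

(* divdiff_at f z i r is f[z_i, ..., z_{i+r}]. *)
Fixpoint divdiff_at f z i r : R :=
  if r is r'.+1 then
    (divdiff_at f z i.+1 r' - divdiff_at f z i r') / (z (i + r)%N - z i)
  else f (z i).

Definition divdiff f (s : seq R) : R :=
  divdiff_at f (fun i => nth 0 s i) 0 (size s).-1.

(* When no i satisfies x_i < u <= x_{i+1}, the value is f u: on `[a, b] with
   x_{n+1} = b this is exactly the case u <= x_1. *)
Definition dderiv x n l f u : R :=
  if l == 0%N then f u else
  match [pick i : 'I_n.+1 | (1 <= i)%N && (x i < u <= x i.+1)] with
  | Some i =>
      if (l <= i)%N then
        l`!%:R * divdiff f (rcons [seq x j | j <- index_iota (i.+1 - l) i.+1] u)
      else
        i`!%:R * divdiff f (rcons [seq x j | j <- index_iota 1 i.+1] u)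
  | None => f u
  end.

(* The knots t_1, ..., t_r completed with t_0 = a and t_{r+1} = b. *)
Definition ext_knot a b r t i : R :=
  if i == 0%N then a else if (i <= r)%N then t i else b.

Definition piece a b r t i : interval R :=
  let T := ext_knot a b r t in
  if i == 0%N then `[T 0%N, T 1%N] else `]T i, T i.+1].

(* DNS^k_n(t_{1:r}, [a, b]) for k = 2m - 1. *)
Definition dns x n k m a b r t : set (R -> R) :=
  [set f | exists p : nat -> {poly R},
    [/\ forall i, (i <= r)%N ->
          (size (p i) <= k.+1)%N /\
          {in piece a b r t i, forall u, f u = (p i).[u]},
        forall i l, (1 <= i <= r)%N -> (l < k)%N ->
          dderiv x n l (horner (p i.-1)) (t i)
            = dderiv x n l (horner (p i)) (t i)
      & forall l, (m <= l <= k)%N ->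
          dderiv x n l (horner (p 0%N)) (t 1%N) = 0 /\
          dderiv x n l (horner (p r)) (t r) = 0]].

Definition hbasis x k j u : R :=
  if (j <= k.+1)%N then
    (j.-1)`!%:R^-1 * \prod_(1 <= l < j) (u - x l)
  else
    k`!%:R^-1 * (\prod_(j - k <= l < j) (u - x l)) * (x j.-1 < u)%R%:R.

Definition dspline x n k a b : set (R -> R) :=
  span_on a b [seq hbasis x k j | j <- index_iota 1 n.+1].

Definition is_dbspline x n k a b j f : Prop :=
  dspline x n k a b f /\
  forall i, (1 <= i <= n)%N -> f (x i) = (i == j)%:R.

(* See dbsplineP and dbspline_unique for existence and for uniqueness
   on [a, b]. *)
Definition dbspline x n k a b j : R -> R :=
  xget (fun=> 0) (is_dbspline x n k a b j).

Definition leftspline x n k a b j u : R :=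
  \sum_(1 <= i < k.+2) x i ^+ j.-1 * dbspline x n k a b i u.

Definition rightspline x n k a b j u : R :=
  \sum_(n - k <= i < n.+1)
    (x i - x (n - k - 1)%N) ^+ j.-1 * dbspline x n k a b i u.

(* L_1, ..., L_m, N_{k+2}, ..., N_{n-k-1}, R_1, ..., R_m. *)
Definition dns_family x n k m a b : seq (R -> R) :=
  [seq leftspline x n k a b j | j <- index_iota 1 m.+1] ++
  [seq dbspline x n k a b j | j <- index_iota k.+2 (n - k)] ++
  [seq rightspline x n k a b j | j <- index_iota 1 m.+1].

Section DBSplines.
Variables (x : nat -> R) (n k : nat) (a b : R).
Hypothesis ax : a <= x 1%N.
Hypothesis xb : x n <= b.
Hypothesis xlt : forall i j, (1 <= i)%N -> (i < j)%N -> (j <= n)%N -> x i < x j.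

Let A : 'M[R]_n := \matrix_(i, j) hbasis x k j.+1 (x i.+1).

Let xle i j : (1 <= i)%N -> (i <= j)%N -> (j <= n)%N -> x i <= x j.
Proof.
move=> i1; rewrite leq_eqVlt => /predU1P[-> //|ij] jn.
by rewrite ltW ?xlt.
Qed.

Let hbasis_lt i j : (1 <= i)%N -> (i < j)%N -> (j <= n)%N ->
  hbasis x k j (x i) = 0.
Proof.
move=> i1 ij jn; rewrite /hbasis; case: ifP => jk.
  suff -> : \prod_(1 <= l < j) (x i - x l) = 0 by rewrite mulr0.
  by rewrite (big_cat_nat i1 (ltnW ij)) /= (big_ltn ij) subrr mul0r mulr0.
rewrite ltNge xle ?mulr0 //; first by case: (j) ij.
by rewrite (leq_trans _ jn) ?leq_pred.
Qed.

Let hbasis_diag j : (1 <= j <= n)%N -> hbasis x k j (x j) != 0.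
Proof.
move=> /andP[j1 jn]; rewrite /hbasis.
have P c : (1 <= c)%N -> \prod_(c <= l < j) (x j - x l) != 0.
  move=> c1; rewrite prodf_seq_neq0; apply/allP => l.
  rewrite mem_index_iota => /andP[cl lj].
  by rewrite subr_eq0 gt_eqF // xlt ?(leq_trans c1).
have F c : c`!%:R^-1 != 0 :> R by rewrite invr_eq0 pnatr_eq0 -lt0n fact_gt0.
case: (leqP j k.+1) => jk; first by rewrite mulf_neq0 ?P.
rewrite xlt; last 3 first.
- by case: (j) jk => [|[|j']].
- by rewrite prednK.
- by [].
by rewrite mulr1 mulf_neq0 ?P // subn_gt0 (ltn_trans _ jk).
Qed.

Let A_unit : A \in unitmx.
Proof.
rewrite unitmxE det_trig; last first.
  by apply/is_trig_mxP => i j ij; rewrite mxE hbasis_lt.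
rewrite unitfE; apply/prodf_neq0 => i _; rewrite mxE hbasis_diag //.
by rewrite /= ltn_ord.
Qed.

Let span_hbasis (c : nat -> R) u :
  \sum_(i < size [seq hbasis x k j | j <- index_iota 1 n.+1])
     c i * nth (fun=> 0) [seq hbasis x k j | j <- index_iota 1 n.+1] i u
  = \sum_(i < n) c i * hbasis x k i.+1 u.
Proof.
rewrite /index_iota subSS subn0 size_map size_iota; apply: eq_bigr => i _.
by rewrite (nth_map 0%N) ?size_iota // nth_iota // add1n.
Qed.

Let x_in (i : 'I_n) : x i.+1 \in `[a, b].
Proof.
have i_n := ltn_ord i; rewrite in_itv /= (le_trans ax) ?xle //=.
by apply: le_trans xb; rewrite xle.
Qed.

Lemma dbsplineP j : is_dbspline x n k a b j (dbspline x n k a b j).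
Proof.
apply: xgetPex.
pose v : 'cV[R]_n := invmx A *m (\col_i (i.+1 == j)%:R).
pose c i := if insub i is Some o then v o 0 else 0.
exists (fun u => \sum_(i < n) c i * hbasis x k i.+1 u); split.
  by exists c => u _; rewrite span_hbasis.
case=> // i /andP[_ lt_in].
have /matrixP/(_ (Ordinal lt_in) 0) : A *m v = \col_i (i.+1 == j)%:R.
  by rewrite mulKVmx ?A_unit.
rewrite !mxE /= => <-; apply: eq_bigr => l _.
by rewrite mxE /c valK mulrC.
Qed.

Lemma dbspline_unique j f :
  is_dbspline x n k a b j f -> {in `[a, b], f =1 dbspline x n k a b j}.
Proof.
case=> -[c fc] fx; have [[d gd] gx] := dbsplineP j.
suff cd (i : 'I_n) : c i = d i.
  move=> u uab; rewrite fc // gd // !span_hbasis.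
  by apply: eq_bigr => i _; rewrite cd.
pose w := \col_(i < n) (c i - d i).
have Aw : A *m w = 0.
  apply/matrixP => l o; rewrite !mxE.
  under eq_bigr => l' _ do rewrite !mxE mulrC mulrBl.
  rewrite sumrB -!span_hbasis -(fc _ (x_in l)) -(gd _ (x_in l)).
  by rewrite fx ?gx ?subrr //= ltn_ord.
have /matrixP/(_ i 0) : w = 0 by rewrite -(mulKmx A_unit w) Aw mulmx0.
by rewrite !mxE => /subr0_eq.
Qed.

End DBSplines.
End Defs.

(* Main.v *)
Require Import Defs.
From mathcomp Require Import all_boot all_order all_algebra.
From mathcomp Require Import boolp classical_sets reals.
From mathcomp Require Import zify ring.
Import Order.TTheory GRing.Theory Num.Theory.
Local Open Scope ring_scope.

Set Implicit Arguments.
Unset Strict Implicit.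
Unset Printing Implicit Defensive.

(** The discrete derivatives at a knot are divided differences at consecutive
    design points, so every condition in the definition of a discrete natural
    spline f is a condition on values at design points.

    Equality of the derivatives of orders below k of p_{i-1} and p_i at the knot
    x_{k+i} says that the two polynomials agree at x_{i+1}, ..., x_{i+k}
    ([dderiv_match]). Moving from piece to piece, p_i is therefore the polynomial
    of degree at most k interpolating f at x_{i+1}, ..., x_{i+k+1}
    ([spline_pieces_interp]). In particular a discrete spline is determined by
    its values at x_1, ..., x_n, and it is the combination of the N_j with these
    values as coefficients ([discrete_splineE]).

    Since the divided difference of order l of a polynomial of degree at most l
    is its coefficient of degree l ([divdiff_at_poly]), the end conditions say
    that p_0 and p_r have degree below m ([dderiv_natural]). These are the
    interpolants at the first and at the last k + 1 points, so f is natural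
    exactly when the data at the first k + 1 points come from a polynomial of
    degree below m, and likewise at the last k + 1 points ([dnsE]). As
    n >= 2k + 2, these two groups of points are disjoint and the data at the
    points in between are free. The space of such data is spanned by the powers
    x_i^{j-1} on the first group, the powers (x_i - x_{n-k-1})^{j-1} on the last
    group, and the unit vectors in between: these are the values of the L_j,
    the R_j and the remaining N_j ([natural_span], [dns_family_natural]). *)

(** * Divided differences *)

Section DividedDifferences.
Variable R : realType.
Implicit Types (f g : R -> R) (z : nat -> R) (p q : {poly R}) (i r n : nat).

Lemma divdiff_atS f z i r :
  divdiff_at f z i r.+1
    = (divdiff_at f z i.+1 r - divdiff_at f z i r) / (z (i + r.+1)%N - z i).
Proof. by []. Qed.

Lemma eq_divdiff_at f g z i r :
  (forall l, (i <= l <= i + r)%N -> f (z l) = g (z l)) ->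
  divdiff_at f z i r = divdiff_at g z i r.
Proof.
elim: r i => [|r IHr] i fg /=; first by apply: fg; lia.
by rewrite (IHr i.+1) ?(IHr i) // => l lr; apply: fg; lia.
Qed.

Lemma eq_divdiff_at_nodes f z y i j r :
  (forall l, (l <= r)%N -> z (i + l)%N = y (j + l)%N) ->
  divdiff_at f z i r = divdiff_at f y j r.
Proof.
elim: r i j => [|r IHr] i j zy /=.
  by have := zy 0%N isT; rewrite !addn0 => ->.
have z0 := zy 0%N isT; rewrite !addn0 in z0; rewrite zy // z0.
rewrite (IHr i j) => [|l lr]; last by apply: zy; lia.
by rewrite (IHr i.+1 j.+1) // => l lr; rewrite !addSnnS zy.
Qed.

Lemma divdiff_atD f g z i r (c : R) :
  divdiff_at (fun u => c * f u + g u) z i r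
    = c * divdiff_at f z i r + divdiff_at g z i r.
Proof. by elim: r i => [//|r IHr] i /=; rewrite !IHr; ring. Qed.

(** Solving the defining quotient for the lower-order difference peels the
    points off from the right, until only the value at the first one is left. *)
Lemma divdiff_at_determines f g z i r :
  (forall l, (i < l <= i + r)%N -> z i != z l) ->
  divdiff_at f z i r = divdiff_at g z i r ->
  (forall l, (i < l <= i + r)%N -> f (z l) = g (z l)) ->
  f (z i) = g (z i).
Proof.
elim: r => [//|r IHr] zi /= + fg.
rewrite (@eq_divdiff_at f g z i.+1 r); last by move=> l lr; apply: fg; lia.
have /mulIf inj : (z (i + r.+1)%N - z i)^-1 != 0.
  by rewrite invr_eq0 subr_eq0 eq_sym zi //; lia.
move=> /inj/addrI/oppr_inj/IHr; apply=> l lr; first by apply: zi; lia.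
by apply: fg; lia.
Qed.

(** This is what turns equality of discrete derivatives at a knot into equality
    of values. The value at z_{q-s} is recovered from the difference of order s
    once the values at the points after it are known. *)
Lemma eq_divdiff_at_iff f g z (q d : nat) :
  (d <= q)%N ->
  (forall i j, (q - d <= i)%N -> (i < j)%N -> (j <= q)%N -> z i != z j) ->
  (forall l, (l <= d)%N -> divdiff_at f z (q - l) l = divdiff_at g z (q - l) l)
  <-> (forall l, (q - d <= l <= q)%N -> f (z l) = g (z l)).
Proof.
move=> dq zd; split=> [D l lq|fg l ld]; last first.
  by apply: eq_divdiff_at => j jl; apply: fg; lia.
rewrite -(@subKn l q); last lia.
have: (q - l <= d)%N by lia.
elim/ltn_ind: (q - l)%N => s IHs sd.
apply: divdiff_at_determines (D _ sd) _ => j js.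
  by apply: zd; lia.
by have := IHs (q - j)%N; rewrite subKn; [apply; lia|lia].
Qed.

(** The Leibniz rule for a linear factor, which loses one of its two terms
    because the factor vanishes at the first node. *)
Lemma divdiff_at_mul f z i r :
  (forall j l, (i <= j)%N -> (j < l)%N -> (l <= i + r.+1)%N -> z j != z l) ->
  divdiff_at (fun u => (u - z i) * f u) z i r.+1 = divdiff_at f z i.+1 r.
Proof.
elim: r i => [|r IHr] i zd.
  rewrite /= subrr mul0r subr0 addn1 mulrC mulKf //.
  by rewrite subr_eq0 eq_sym zd //; lia.
rewrite divdiff_atS IHr; last by move=> j l *; apply: zd; lia.
have -> : divdiff_at (fun u => (u - z i) * f u) z i.+1 r.+1
    = (z i.+1 - z i) * divdiff_at f z i.+1 r.+1
      + divdiff_at (fun u => (u - z i.+1) * f u) z i.+1 r.+1.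
  by rewrite -divdiff_atD; apply: eq_divdiff_at => l _; ring.
rewrite IHr; last by move=> j l *; apply: zd; lia.
have zn : z (i.+1 + r.+1)%N - z i.+1 != 0.
  by rewrite subr_eq0 eq_sym zd //; lia.
have -> : divdiff_at f z i.+2 r
    = (z (i.+1 + r.+1)%N - z i.+1) * divdiff_at f z i.+1 r.+1
      + divdiff_at f z i.+1 r.
  by rewrite divdiff_atS mulrC divfK ?subrK.
have zn' : z (i.+1 + r.+1)%N - z i != 0.
  by rewrite subr_eq0 eq_sym zd //; lia.
by rewrite -[(i + r.+2)%N]addSnnS; field.
Qed.

(** Writing p = c + (X - z_i) q, the constant c contributes nothing and the
    Leibniz rule reduces p to q, whose coefficient of degree r - 1 is the one of
    p of degree r. *)
Lemma divdiff_at_poly p z i r :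
  (forall j l, (i <= j)%N -> (j < l)%N -> (l <= i + r)%N -> z j != z l) ->
  (size p <= r.+1)%N -> divdiff_at (horner p) z i r = p`_r.
Proof.
elim: r i p => [|r IHr] i p zd sp.
  by rewrite [p]size1_polyC //= hornerC coefC.
have [q pE] : exists q, p = q * ('X - (z i)%:P) + (p.[z i])%:P.
  have /factor_theorem[q /eqP] : root (p - (p.[z i])%:P) (z i).
    by rewrite /root !hornerE subrr.
  by rewrite subr_eq => /eqP ->; exists q; rewrite !hornerE subrr mulr0 add0r.
move: (p.[z i]) pE => c pE; rewrite {}pE in sp *.
have sq : (size q <= r.+1)%N.
  have [->|q0] := eqVneq q 0; first by rewrite size_poly0.
  move: sp; rewrite size_polyDl size_Mmonic ?monicXsubC // size_XsubC.
    by lia.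
  rewrite (leq_ltn_trans (size_polyC_leq1 _)) //.
  by move: q0; rewrite -size_poly_gt0; lia.
have -> : (q * ('X - (z i)%:P) + c%:P)`_r.+1 = q`_r.
  rewrite coefD coefC addr0 mulrBr coefB coefMX coefMC /=.
  by rewrite [q`_r.+1]nth_default // mul0r subr0.
have divdiff_cst j s : divdiff_at (fun=> c) z j s.+1 = 0.
  elim: s j => [|s IHs] j; first by rewrite /= subrr mul0r.
  by rewrite divdiff_atS !IHs subrr mul0r.
(* The factor 1 gives g the shape c * f + h of [divdiff_atD]. *)
pose g (u : R) : R := 1 * ((u - z i) * q.[u]) + c.
transitivity (divdiff_at g z i r.+1).
  by apply: eq_divdiff_at => l _; rewrite /g !hornerE; ring.
rewrite divdiff_atD divdiff_cst addr0 mul1r divdiff_at_mul // IHr // => *.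
by apply: zd; lia.
Qed.

(** If p had degree d with m <= d <= k, its divided difference of order d would
    be the leading coefficient; conversely each divided difference of order
    l >= m is the coefficient of degree l. *)
Lemma divdiff_at_size p z (q m k : nat) :
  (k <= q)%N ->
  (forall i j, (q - k <= i)%N -> (i < j)%N -> (j <= q)%N -> z i != z j) ->
  (size p <= k.+1)%N ->
  (forall l, (m <= l <= k)%N -> divdiff_at (horner p) z (q - l) l = 0)
  <-> (size p <= m)%N.
Proof.
move=> kq zd sp; split=> [D|pm l /andP[ml lk]]; last first.
  rewrite divdiff_at_poly; first by rewrite nth_default ?(leq_trans pm).
    by move=> i j *; apply: zd; lia.
  by rewrite (leq_trans pm) ?leqW.
rewrite leqNgt; apply/negP => mp.
have /D : (m <= (size p).-1 <= k)%N.
  by move: mp sp; case: (size p) => [|s] /=; lia.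
rewrite divdiff_at_poly; last 2 first.
- by move=> i j *; apply: zd; lia.
- by rewrite prednK; lia.
by rewrite -lead_coefE => /eqP; rewrite lead_coef_eq0 -size_poly_eq0 => /eqP; lia.
Qed.

End DividedDifferences.

(** * Spans of functions on an interval *)

Section Spans.
Variables (R : realType) (a b : R).
Implicit Types (f g : R -> R) (s : seq (R -> R)) (P : set (R -> R)).

(** Linear subspaces of the functions on [a, b]. A function on [a, b] is
    represented by a total function, hence the closure under equality on
    [a, b]. *)
Record fun_subspace P : Prop := FunSubspace {
  fun_subspace0 : P (fun=> 0);
  fun_subspaceD : forall c f g, P f -> P g -> P (fun u => c * f u + g u);
  fun_subspace_eq : forall f g, {in `[a, b], f =1 g} -> P g -> P f }.

Lemma fun_subspace_sum P I (r : seq I) (Q : pred I) (c : I -> R)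
    (F : I -> R -> R) :
  fun_subspace P -> (forall i, Q i -> P (F i)) ->
  P (fun u => \sum_(i <- r | Q i) c i * F i u).
Proof.
move=> [P0 PD Peq] PF; elim: r => [|i r IHr].
  by apply: Peq P0 => u _; rewrite big_nil.
case: (boolP (Q i)) => Qi.
  apply: Peq (PD (c i) _ _ (PF i Qi) IHr) => u _.
  by rewrite big_cons Qi.
by apply: Peq IHr => u _; rewrite big_cons (negPf Qi).
Qed.

Lemma span_on_subspace s : fun_subspace (span_on a b s).
Proof.
split.
- by exists (fun=> 0) => u _; rewrite big1 // => i _; rewrite mul0r.
- move=> c f g [d fd] [e ge]; exists (fun i => c * d i + e i) => u uab.
  rewrite fd // ge // mulr_sumr -big_split; apply: eq_bigr => i _ /=.
  by rewrite mulrDl mulrA.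
- by move=> f g fg [c gc]; exists c => u uab; rewrite fg ?gc.
Qed.

Lemma mem_span_on s f : f \in s -> span_on a b s f.
Proof.
move=> fs; exists (fun i => (i == index f s)%:R) => u _.
have fsz : (index f s < size s)%N by rewrite index_mem.
rewrite (bigD1 (Ordinal fsz)) //= eqxx mul1r nth_index // big1 ?addr0 //.
by move=> i /negPf ni; rewrite -[_ == _ :> nat]/(i == Ordinal fsz) ni mul0r.
Qed.

Lemma span_on_sub P s :
  fun_subspace P -> (forall f, f \in s -> P f) -> (span_on a b s `<=` P)%classic.
Proof.
move=> Psub Ps f [c fc]; apply: (fun_subspace_eq Psub fc).
by apply: fun_subspace_sum => // i _; apply/Ps/mem_nth.
Qed.

End Spans.

(** * Discrete splines as piecewise interpolants *)

Section DiscreteSplines.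
Variables (R : realType) (k n : nat) (a b : R) (x : nat -> R).
Hypothesis kn : (k.+2 <= n)%N.
Hypothesis hax : a <= x 1%N.
Hypothesis hxb : x n <= b.
Hypothesis hx : forall i j : nat,
  (1 <= i)%N -> (i < j)%N -> (j <= n)%N -> x i < x j.
Implicit Types (f g : R -> R) (p q : nat -> {poly R}).

Local Notation r := (n - k - 1)%N.
Local Notation knot i := (ext_knot a b r (fun j => x (k + j)%N) i).
Local Notation dpiece i := (piece a b r (fun j => x (k + j)%N) i).

Lemma node_le i j : (1 <= i)%N -> (i <= j)%N -> (j <= n)%N -> x i <= x j.
Proof.
move=> i1; rewrite leq_eqVlt => /predU1P[-> //|ij] jn.
by rewrite ltW ?hx.
Qed.

Lemma node_neq i j : (1 <= i)%N -> (i < j)%N -> (j <= n)%N -> x i != x j.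
Proof. by move=> *; rewrite lt_eqF ?hx. Qed.

Lemma node_in i : (1 <= i <= n)%N -> x i \in `[a, b].
Proof.
move=> /andP[i1 i_n]; rewrite in_itv /= (le_trans hax) ?node_le //=.
by rewrite (le_trans _ hxb) ?node_le.
Qed.

Lemma knot_in i : knot i \in `[a, b].
Proof.
rewrite /ext_knot; have ab : a <= b.
  by rewrite (le_trans hax) // (le_trans _ hxb) ?node_le //; lia.
case: ifP => i0; first by rewrite in_itv /= lexx.
case: ifP => ir; last by rewrite in_itv /= lexx andbT.
by apply: node_in; lia.
Qed.

Lemma piece_sub i u : u \in dpiece i -> u \in `[a, b].
Proof.
have := knot_in i; have := knot_in i.+1; rewrite /piece !in_itv /=.
case: ifP => [/eqP ->|_] /andP[_ Tb] /andP[aT _] /andP[Tu uT].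
  by rewrite (le_trans aT) //= (le_trans uT).
by rewrite (le_trans aT (ltW Tu)) (le_trans uT).
Qed.

Lemma piece_cover u : u \in `[a, b] -> exists2 i, (i <= r)%N & u \in dpiece i.
Proof.
rewrite in_itv /= => /andP[au ub].
suff H s : u <= knot s.+1 -> exists2 i, (i <= s)%N & u \in dpiece i.
  by apply: H; rewrite /ext_knot /= ltnn.
elim: s => [u1|s IHs us].
  by exists 0%N; rewrite // /piece in_itv /= au.
have [/IHs[i si ui]|su] := leP u (knot s.+1); first by exists i; lia.
by exists s.+1; rewrite // /piece in_itv /= su.
Qed.

Lemma node_in_piece i : (i <= r)%N -> x (i + k).+1 \in dpiece i.
Proof.
move=> ir; rewrite /piece in_itv /= /ext_knot /=.
case: eqP => [->|/eqP i0].
  have -> : (0 < r)%N by lia.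
  by rewrite /= addn1 lexx andbT (le_trans hax) ?node_le //; lia.
rewrite ir /= hx /=; [|lia..].
case: ifP => iR; first by rewrite [(k + _)%N]addnC.
by rewrite (le_trans _ hxb) ?node_le //; lia.
Qed.

Lemma node_in_first_piece l : (1 <= l <= k.+1)%N -> x l \in dpiece 0.
Proof.
move=> lk; rewrite /piece in_itv /= /ext_knot /=.
have -> : (0 < r)%N by lia.
by rewrite /= (le_trans hax) ?node_le //; lia.
Qed.

Lemma interpolant_unique (p q : {poly R}) i :
  (i <= r)%N -> (size p <= k.+1)%N -> (size q <= k.+1)%N ->
  (forall l, (i < l <= (i + k).+1)%N -> p.[x l] = q.[x l]) -> p = q.
Proof.
move=> ir sp sq pq; apply/eqP; rewrite -subr_eq0; apply/eqP.
apply: (@roots_geq_poly_eq0 _ _ [seq x l | l <- index_iota i.+1 (i + k).+2]).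
- apply/allP => _ /mapP[l + ->]; rewrite mem_index_iota => lr.
  by rewrite /root !hornerE pq ?subrr //; lia.
- rewrite map_inj_in_uniq ?iota_uniq // => l l'.
  rewrite !mem_index_iota => lr lr' ll'; apply/eqP.
  case: (ltngtP l l') => // lt.
    have : x l != x l' by apply: node_neq; lia.
    by rewrite ll' eqxx.
  have : x l' != x l by apply: node_neq; lia.
  by rewrite ll' eqxx.
- rewrite size_map size_iota (leq_trans (size_polyD _ _)) // size_polyN.
  by rewrite geq_max (leq_trans sp) ?(leq_trans sq) //; lia.
Qed.

(** The smoothness condition at the knot x_{k+i}, equality of the discrete
    derivatives of orders below k, involves the values at the k points
    x_{i+1}, ..., x_{i+k}: two neighbouring pieces must agree there. *)
Definition spline_pieces f p : Prop :=
  (forall i, (i <= r)%N ->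
     (size (p i) <= k.+1)%N /\ {in dpiece i, forall u, f u = (p i).[u]}) /\
  (forall i l, (1 <= i <= r)%N -> (i < l <= i + k)%N ->
     (p i.-1).[x l] = (p i).[x l]).

Definition discrete_spline f : Prop := exists p, spline_pieces f p.

(** For i > 0 only the last of the points x_{i+1}, ..., x_{i+k+1} lies in the
    i-th piece; the values at the others are handed over from p_{i-1}. *)
Lemma spline_pieces_interp f p i l :
  spline_pieces f p -> (i <= r)%N -> (i < l <= (i + k).+1)%N ->
  (p i).[x l] = f (x l).
Proof.
move=> [pf pm]; elim: i l => [|i IHi] l ir lr.
  by have [_ <- //] := pf 0%N ir; apply: node_in_first_piece.
have [->|li] := eqVneq l (i.+1 + k).+1.
  by have [_ <- //] := pf i.+1 ir; apply: node_in_piece.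
by rewrite -pm /=; [apply: IHi; lia|lia..].
Qed.

(** Both functions have on each piece the unique interpolant of the common
    data. *)
Lemma discrete_spline_unique f g :
  discrete_spline f -> discrete_spline g ->
  (forall i, (1 <= i <= n)%N -> f (x i) = g (x i)) -> {in `[a, b], f =1 g}.
Proof.
move=> [p pf] [q qg] fg u /piece_cover[i ir ui].
have [[sp ->//] [sq ->//]] := (pf.1 i ir, qg.1 i ir).
congr (_.[_]); apply: (interpolant_unique ir) => // l lr.
by rewrite (spline_pieces_interp pf) ?(spline_pieces_interp qg) ?fg //; lia.
Qed.

Lemma discrete_spline_subspace : fun_subspace a b discrete_spline.
Proof.
split.
- exists (fun=> 0); split=> [i ir|//]; rewrite size_poly0; split=> // u _.
  by rewrite horner0.
- move=> c f g [p [pf pm]] [q [qg qm]].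
  exists (fun i => c *: p i + q i); split=> [i ir|i l ir lr].
    have [[sp pE] [sq qE]] := (pf i ir, qg i ir).
    split=> [|u ui]; last by rewrite !hornerE pE ?qE.
    rewrite (leq_trans (size_polyD _ _)) // geq_max sq andbT.
    by rewrite (leq_trans (size_scale_leq _ _)).
  by rewrite !hornerE pm ?qm.
- move=> f g fg [p [pg pm]]; exists p; split=> // i ir.
  have [sp pE] := pg i ir; split=> // u ui.
  by rewrite fg ?pE // (piece_sub ui).
Qed.

(** For j > k + 1 the function h_j switches on at the knot x_{j-1}, where its
    polynomial vanishes at the k points used by the smoothness condition. *)
Lemma hbasis_discrete_spline j : (1 <= j <= n)%N -> discrete_spline (hbasis x k j).
Proof.
move=> j1n; case: (leqP j k.+1) => jk.
  exists (fun=> (j.-1)`!%:R^-1 *: \prod_(1 <= l < j) ('X - (x l)%:P)).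
  split=> // i ir; split=> [|u _].
    rewrite (leq_trans (size_scale_leq _ _)) // size_prod_XsubC size_iota.
    by lia.
  rewrite /hbasis jk hornerZ horner_prod; congr (_ * _).
  by apply: eq_bigr => l _; rewrite !hornerE.
pose P := k`!%:R^-1 *: \prod_(j - k <= l < j) ('X - (x l)%:P).
exists (fun i => if (j <= i + k.+1)%N then P else 0); split=> [i ir|i l ir lr].
  split=> [|u].
    case: ifP => // _; last by rewrite size_poly0.
    rewrite (leq_trans (size_scale_leq _ _)) // size_prod_XsubC size_iota.
    by lia.
  rewrite /piece /ext_knot in_itv /= /hbasis [(j <= k.+1)%N]leqNgt jk /= => ui.
  case: ifP => ji.
    have -> : x j.-1 < u.
      move: ui; have /negPf -> : i != 0%N by lia.
      rewrite ir => /andP[+ _]; apply: le_lt_trans; apply: node_le; lia.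
    rewrite mulr1 hornerZ horner_prod; congr (_ * _).
    by apply: eq_bigr => l _; rewrite !hornerE.
  have -> : x j.-1 < u = false.
    apply/negbTE; rewrite -leNgt (@le_trans _ _ (x (k + i.+1)%N)) //; last first.
      by apply: node_le; lia.
    have [r0 ri] : (0 < r)%N /\ (i < r)%N by lia.
    by move: ui; case: eqP => [->|_]; rewrite ?r0 ?ri => /andP[].
  by rewrite mulr0 horner0.
case: ifP => ji; case: ifP => ji' //; first by lia.
rewrite /P hornerZ horner_prod (bigD1_seq l) ?iota_uniq //=.
  by rewrite hornerXsubC subrr mul0r mulr0 horner0.
by rewrite mem_index_iota; lia.
Qed.

Lemma dbspline_discrete_spline j : discrete_spline (dbspline x n k a b j).
Proof.
have [+ _] := @dbsplineP R x n k a b hx j.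
apply: (span_on_sub discrete_spline_subspace) => _ /mapP[i + ->].
by rewrite mem_index_iota => ?; apply: hbasis_discrete_spline.
Qed.

Lemma dbspline_node j i :
  (1 <= i <= n)%N -> dbspline x n k a b j (x i) = (i == j)%:R.
Proof. by have [_] := @dbsplineP R x n k a b hx j; apply. Qed.

Lemma dbspline_sum_node (c : nat -> R) (s t i : nat) :
  (1 <= i <= n)%N ->
  \sum_(s <= j < t) c j * dbspline x n k a b j (x i)
    = if (s <= i < t)%N then c i else 0.
Proof.
move=> i_n; under eq_bigr => j _ do rewrite dbspline_node // mulr_natr mulrb.
rewrite -big_mkcond /=; under eq_bigl => j do rewrite eq_sym.
rewrite -big_filter; case: ifP => ist.
  by rewrite filter_pred1_uniq ?iota_uniq ?mem_index_iota ?big_seq1.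
rewrite big_filter big_seq_cond big1 // => j.
by rewrite mem_index_iota => /andP[+ /eqP ji]; rewrite ji ist.
Qed.

Lemma discrete_splineE f : discrete_spline f ->
  {in `[a, b], forall u,
    f u = \sum_(1 <= j < n.+1) f (x j) * dbspline x n k a b j u}.
Proof.
move=> sf; apply: discrete_spline_unique => // [|i i_n].
  apply: (fun_subspace_sum _ _ discrete_spline_subspace) => j _.
  exact: dbspline_discrete_spline.
by rewrite dbspline_sum_node // ifT //; lia.
Qed.

(** * Smoothness and naturality as conditions on the data *)

(** As u lies in (x_{q-1}, x_q] for u = x_q, the point u is both the
    evaluation point and the node following x_{q-1}: the points of the divided
    difference are x_{q-l}, ..., x_q. *)
Lemma dderiv_node f (q l : nat) : (l < q <= n)%N ->
  dderiv x n l f (x q) = l`!%:R * divdiff_at f x (q - l) l.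
Proof.
move=> lq; rewrite /dderiv; case: eqP => [->|/eqP l0].
  by rewrite fact0 mul1r subn0.
case: pickP => [i /andP[i1 /andP[iq qi]]|none]; last first.
  have qn : (q.-1 < n.+1)%N by lia.
  have /negP[] := none (Ordinal qn); rewrite /= hx; [|lia..].
  by rewrite prednK ?lexx //; lia.
have i_n := ltn_ord i.
have Eq : q = i.+1.
  have [qi'|iq'|//] := ltngtP q i.+1.
    by move: iq; rewrite ltNge node_le //; lia.
  by move: qi; rewrite leNgt hx //; lia.
rewrite Eq; have -> : (l <= i)%N by lia.
congr (_ * _); rewrite /divdiff size_rcons size_map size_iota /=.
have -> : (i.+1 - (i.+1 - l))%N = l by lia.
apply: eq_divdiff_at_nodes => j jl; rewrite add0n nth_rcons size_map size_iota.
case: ltnP => jl'.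
  by rewrite (nth_map 0%N) ?nth_iota ?size_iota.
have -> : j = l by lia.
rewrite ifT; last by apply/eqP; lia.
by rewrite subnK //; lia.
Qed.

Lemma dderiv_match f g i : (1 <= i <= r)%N ->
  (forall l, (l < k)%N ->
     dderiv x n l f (x (k + i)%N) = dderiv x n l g (x (k + i)%N))
  <-> (forall l, (i < l <= i + k)%N -> f (x l) = g (x l)).
Proof.
move=> ir; have [->|k0] := posnP k.
  by split=> [_ l|_ l]; [lia|].
have := @eq_divdiff_at_iff R f g x (k + i) k.-1 _ _.
move=> /(_ ltac:(lia)) /(_ ltac:(move=> *; apply: node_neq; lia)) [D1 D2].
split=> [D l lr|fg l lk].
  apply: D1 => [j jk|]; last lia.
  have := D j; rewrite !dderiv_node; [|lia..].
  move=> /(_ ltac:(lia)); apply: mulfI.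
  by rewrite pnatr_eq0 -lt0n fact_gt0.
rewrite !dderiv_node; [|lia..].
by rewrite D2 // => [j jr|]; [apply: fg|]; lia.
Qed.

Lemma dderiv_natural (p : {poly R}) (m q : nat) : (k < q <= n)%N ->
  (size p <= k.+1)%N ->
  (forall l, (m <= l <= k)%N -> dderiv x n l (horner p) (x q) = 0)
  <-> (size p <= m)%N.
Proof.
move=> kq sp; rewrite -(@divdiff_at_size R p x q m k) //; [|lia|]; last first.
  by move=> *; apply: node_neq; lia.
split=> D l lr.
  have := D l lr; rewrite dderiv_node; last lia.
  move/eqP; rewrite mulf_eq0 pnatr_eq0 gtn_eqF ?fact_gt0 //=.
  by move/eqP.
by rewrite dderiv_node ?D ?mulr0 //; lia.
Qed.

Definition natural_data m f : Prop := exists q0 q1 : {poly R},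
  [/\ (size q0 <= m)%N, (size q1 <= m)%N,
      forall i, (1 <= i <= k.+1)%N -> f (x i) = q0.[x i]
    & forall i, (n - k <= i <= n)%N -> f (x i) = q1.[x i]].

(** The two end pieces interpolate the data at the first and at the last k + 1
    points; by uniqueness of the interpolant they have degree below m if and
    only if the data there come from a polynomial of degree below m. *)
Lemma dnsE m f : (m <= k.+1)%N ->
  dns x n k m a b r (fun i => x (k + i)%N) f
  <-> discrete_spline f /\ natural_data m f.
Proof.
move=> mk.
have [q0n qrn] : (k < k + 1 <= n)%N /\ (k < k + r <= n)%N by lia.
split=> [[p [pf pm p0]]|[[p pf] [q0 [q1 [s0 s1 fq0 fq1]]]]].
  have P : spline_pieces f p.
    split=> // i l ir; apply: (dderiv_match _ _ ir).1 => j jk.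
    exact: pm.
  split; first by exists p.
  have [sp0 _] := pf 0%N isT; have [spr _] := pf r (leqnn _).
  exists (p 0%N), (p r); split.
  - by apply: (dderiv_natural m q0n sp0).1 => l /p0[].
  - by apply: (dderiv_natural m qrn spr).1 => l /p0[].
  - by move=> i ik; rewrite (spline_pieces_interp P).
  - by move=> i ik; rewrite (spline_pieces_interp P) //; lia.
have [pE pm] := pf.
have [sp0 _] := pE 0%N isT; have [spr _] := pE r (leqnn _).
have p0E : p 0%N = q0.
  apply: (@interpolant_unique _ _ 0%N) => // [|l lr]; first exact: leq_trans mk.
  by rewrite (spline_pieces_interp pf) ?fq0.
have prE : p r = q1.
  apply: (@interpolant_unique _ _ r) => // [|l lr]; first exact: leq_trans mk.
  by rewrite (spline_pieces_interp pf) ?fq1 //; lia.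
exists p; split=> //.
- move=> i l ir; apply: (dderiv_match _ _ ir).2 => j; exact: pm.
- move=> l lr; rewrite -p0E -prE in s0 s1; split.
  + exact: (dderiv_natural m q0n sp0).2 lr.
  + exact: (dderiv_natural m qrn spr).2 lr.
Qed.

Lemma natural_subspace m :
  fun_subspace a b (fun f => discrete_spline f /\ natural_data m f).
Proof.
have [S0 SD Seq] := discrete_spline_subspace; split.
- by split=> //; exists 0, 0; rewrite size_poly0; split=> // i _; rewrite horner0.
- move=> c f g [sf [p0 [p1 [s0 s1 f0 f1]]]] [sg [q0 [q1 [t0 t1 g0 g1]]]].
  split; first exact: SD.
  have sD (p q : {poly R}) : (size p <= m)%N -> (size q <= m)%N ->
      (size (c *: p + q)%R <= m)%N.
    move=> sp sq; rewrite (leq_trans (size_polyD _ _)) // geq_max sq andbT.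
    by rewrite (leq_trans (size_scale_leq _ _)).
  exists (c *: p0 + q0), (c *: p1 + q1); split; rewrite ?sD // => i ir.
    by rewrite f0 // g0 // !hornerE.
  by rewrite f1 // g1 // !hornerE.
- move=> f g fg [sg [q0 [q1 [s0 s1 g0 g1]]]]; split; first exact: Seq sg.
  exists q0, q1; split=> // i ir.
    by rewrite fg ?g0 // node_in //; lia.
  by rewrite fg ?g1 // node_in //; lia.
Qed.

(** * The spanning family *)

Lemma leftspline_natural m j : (k.+1 < n - k)%N -> (1 <= j <= m)%N ->
  discrete_spline (leftspline x n k a b j) /\
  natural_data m (leftspline x n k a b j).
Proof.
move=> knk jm; split.
  apply: (fun_subspace_sum _ _ discrete_spline_subspace) => i _.
  exact: dbspline_discrete_spline.
exists 'X^(j.-1), 0; split; first by rewrite size_polyXn; lia.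
- by rewrite size_poly0.
- move=> i ik; rewrite /leftspline dbspline_sum_node; last lia.
  by rewrite ifT ?hornerXn //; lia.
- move=> i ik; rewrite /leftspline dbspline_sum_node; last lia.
  by rewrite ifF ?horner0 //; lia.
Qed.

Lemma rightspline_natural m j : (k.+1 < n - k)%N -> (1 <= j <= m)%N ->
  discrete_spline (rightspline x n k a b j) /\
  natural_data m (rightspline x n k a b j).
Proof.
move=> knk jm; split.
  apply: (fun_subspace_sum _ _ discrete_spline_subspace) => i _.
  exact: dbspline_discrete_spline.
exists 0, (('X - (x (n - k - 1)%N)%:P) ^+ j.-1); split.
- by rewrite size_poly0.
- by rewrite size_exp_XsubC; lia.
- move=> i ik; rewrite /rightspline dbspline_sum_node; last lia.
  by rewrite ifF ?horner0 //; lia.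
- move=> i ik; rewrite /rightspline dbspline_sum_node; last lia.
  by rewrite ifT ?horner_exp ?hornerXsubC //; lia.
Qed.

Lemma dbspline_natural m j : (k.+1 < j < n - k)%N ->
  discrete_spline (dbspline x n k a b j) /\
  natural_data m (dbspline x n k a b j).
Proof.
move=> jk; split; first exact: dbspline_discrete_spline.
exists 0, 0; rewrite size_poly0; split=> // i ir; rewrite horner0.
  have /negPf ij : i != j by lia.
  by rewrite dbspline_node ?ij //; lia.
have /negPf ij : i != j by lia.
by rewrite dbspline_node ?ij //; lia.
Qed.

Lemma sum_poly_dbspline m (q : {poly R}) (c u : R) (s t : nat) :
  (size q <= m)%N ->
  \sum_(s <= i < t) q.[x i - c] * dbspline x n k a b i u
    = \sum_(1 <= j < m.+1) q`_j.-1 *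
        \sum_(s <= i < t) (x i - c) ^+ j.-1 * dbspline x n k a b i u.
Proof.
move=> qm; rewrite big_add1 /= big_mkord.
under [RHS]eq_bigr => j _ do rewrite mulr_sumr.
rewrite exchange_big /=; apply: eq_bigr => i _.
rewrite (horner_coef_wide _ qm) mulr_suml.
by apply: eq_bigr => j _; rewrite mulrA.
Qed.

(** Splitting the expansion of a discrete spline in the functions N_j according
    to the position of x_j, the data at the first and last k + 1 points are
    polynomial; expanding these polynomials in powers of u, respectively of
    u - x_{n-k-1}, turns the two outer sums into combinations of the L_j and
    the R_j. *)
Lemma natural_span m f : (k.+1 < n - k)%N ->
  discrete_spline f -> natural_data m f ->
  span_on a b (dns_family x n k m a b) f.
Proof.
move=> knk sf [q0 [q1 [s0 s1 f0 f1]]].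
(* q1' expands q1 in powers of u - c, the powers occurring in the R_j. *)
set c := x (n - k - 1)%N; pose q1' := q1 \Po ('X + c%:P).
have s1' : (size q1' <= m)%N by rewrite size_comp_poly2 ?size_XaddC.
have Span := span_on_subspace a b (dns_family x n k m a b).
pose g (F : nat -> R -> R) (d : nat -> R) s t u :=
  \sum_(j <- index_iota s t) d j * F j u.
have gS (F : nat -> R -> R) d s t : (forall j, j \in index_iota s t ->
    F j \in dns_family x n k m a b) ->
    span_on a b (dns_family x n k m a b) (g F d s t).
  move=> Fin; apply: (fun_subspace_eq Span (g := fun u =>
    \sum_(j <- index_iota s t | j \in index_iota s t) d j * F j u)).
    by move=> u _; rewrite /g big_seq.
  by apply: (fun_subspace_sum _ _ Span) => j /Fin; apply: mem_span_on.
pose gL := g (leftspline x n k a b) (fun j => q0`_j.-1) 1%N m.+1.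
pose gN := g (dbspline x n k a b) (fun j => f (x j)) k.+2 (n - k)%N.
pose gR := g (rightspline x n k a b) (fun j => q1'`_j.-1) 1%N m.+1.
have : span_on a b (dns_family x n k m a b)
    (fun u => 1 * gL u + (1 * gN u + gR u)).
  do ?[apply: (fun_subspaceD Span)]; apply: gS => j jm;
    by rewrite !mem_cat map_f ?orbT.
apply: (fun_subspace_eq Span) => u uab; rewrite !mul1r.
rewrite (discrete_splineE sf uab).
rewrite (@big_cat_nat _ _ _ k.+2) /=; [|lia..].
rewrite (@big_cat_nat _ _ _ (n - k)%N k.+2) /=; [|lia..].
congr (_ + (_ + _)).
  rewrite /gL /g /leftspline.
  transitivity (\sum_(1 <= i < k.+2) q0.[x i - 0] * dbspline x n k a b i u).
    by apply: eq_big_nat => i ik; rewrite subr0 f0.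
  rewrite (sum_poly_dbspline _ _ _ _ s0); apply: eq_bigr => j _.
  by under eq_bigr => i _ do rewrite subr0.
rewrite /gR /g /rightspline -(sum_poly_dbspline _ _ _ _ s1').
apply: eq_big_nat => i ik; rewrite f1 /q1' ?horner_comp ?hornerE ?subrK //; lia.
Qed.

Lemma dns_family_natural m f : (k.+1 < n - k)%N ->
  f \in dns_family x n k m a b -> discrete_spline f /\ natural_data m f.
Proof.
move=> knk; rewrite !mem_cat => /or3P[] /mapP[j + ->]; rewrite mem_index_iota.
- exact: leftspline_natural.
- exact: dbspline_natural.
- exact: rightspline_natural.
Qed.

End DiscreteSplines.

Theorem lemma9 (R : realType) (k m n : nat) (a b : R) (x : nat -> R)
    (hk : k = (2 * m - 1)%N) (hk1 : (1 <= k)%N)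
    (hn : (2 * k + 2 <= n)%N)
    (hax : a <= x 1%N)
    (hx : forall i j : nat, (1 <= i)%N -> (i < j)%N -> (j <= n)%N -> x i < x j)
    (hxb : x n <= b)
    (hxn1 : x n.+1 = b) :
  size (dns_family x n k m a b) = (n - k - 1)%N /\
  dns x n k m a b (n - k - 1) (fun i => x (k + i)%N)
    = span_on a b (dns_family x n k m a b).
Proof.
split; first by rewrite !size_cat !size_map !size_iota; lia.
have kn : (k.+2 <= n)%N by lia.
have knk : (k.+1 < n - k)%N by lia.
have mk : (m <= k.+1)%N by lia.
apply/seteqP; split=> f.
  by move=> /(dnsE kn hax hxb hx f mk)[]; apply: natural_span.
move=> fs; apply/(dnsE kn hax hxb hx f mk); move: f fs.
apply: (span_on_sub (natural_subspace kn hax hxb hx m)) => f.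
exact: dns_family_natural.
Qed.
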